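(* The local ratio algorithm for Transverse Vertex Cover described in the context is a $(2+\sqrt 2)$-approximation algorithm for the Transverse Vertex Cover problem: on every Transverse Vertex Cover instance $(G,H)$, it runs in polynomial time and outputs a description of a feasible product state $\rho$ with $$\mathrm{Tr}[H\rho]\le (2+\sqrt 2)\,\mu^*(G,H),$$ where $\mu^*(G,H)$ is the optimal value of the instance.
   Context: Qubits are indexed by the vertices of a graph. $X,Y,Z$ are the Pauli matrices, with $Z=|0\rangle\langle 0|-|1\rangle\langle 1|$; a subscript $i$ on an operator means it acts on qubit $i$ and as the identity elsewhere, and $|00\rangle\langle 00|_{ij}$ is the projector onto $|00\rangle$ on qubits $i,j$, tensored with the identity elsewhere. A Hamiltonian is stoquastic if all its off-diagonal entries in the computational basis are real and non-positive. Transverse Vertex Cover (TVC): the input is a (finite, simple, undirected) graph $G=(V,E)$ and a stoquastic $1$-local Hamiltonian $H=\sum_{i\in V}c_i\phi_i$ where for all $i\in V$: $c_i\ge 0$, $\phi_i$ is a rank-1 projector acting on the $i$-th qubit, and $\mathrm{Tr}[Z_i\phi_i]\le 0$ (trace over qubit $i$ only). The optimal value is $$\mu^*(G,H)=\min_\rho \mathrm{Tr}[H\rho]\quad\text{s.t.}\quad \mathrm{Tr}[|00\rangle\langle 00|_{ij}\,\rho]=0\ \ \forall\, ij\in E,\quad \mathrm{Tr}[\rho]=1,\quad \rho\succeq 0,$$ where $\rho$ ranges over operators on $(\mathbb{C}^2)^{\otimes |V|}$. A state is feasible if it satisfies these constraints. Algorithm (input $G$, $H=\sum_i c_i\phi_i$;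 the coefficients $c_i$ below are those of the current, updated $H$): 1. For any $i\in V$ with $c_i=0$, set $\rho_i=|1\rangle\langle 1|$. 2. Choose an (arbitrary) edge $ij\in E$ with $\min\{c_i,c_j\}>0$, and let $H_{ij}=\phi_i+\phi_j$. 3. Update $H\to H-w_{ij}H_{ij}$ where $w_{ij}=\min\{c_i,c_j\}$. 4. Repeat from step 1 until no more edges are left to choose in step 2. 5. For any remaining $i$ with $c_i>0$, set $\rho_i=I-\phi_i$. Output: the product state $\rho=\bigotimes_{i}\rho_i$. *)

(* Defs.v *)
From HB Require Import structures.
From mathcomp Require Import all_boot all_order all_algebra.
From mathcomp Require Import sesquilinear spectral complex.
From mathcomp Require Import classical_sets reals.

Set Implicit Arguments.
Unset Strict Implicit.
Unset Printing Implicit Defensive.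

Import Order.TTheory GRing.Theory Num.Theory.
Local Open Scope ring_scope.
Local Open Scope complex_scope.
Local Open Scope sesquilinear_scope.

Record sgraph (V : finType) := SGraph {
  adj :> rel V;
  adj_sym : symmetric adj;
  adj_irrefl : irreflexive adj }.

Definition edges (V : finType) (G : sgraph V) : {set {set V}} :=
  [set [set e.1; e.2] | e : V * V & G e.1 e.2].

Section Qubits.
Variables (R : realType) (V : finType).
Local Notation C := R[i].

Definition psd n (A : 'M[C]_n) : Prop :=
  A \is hermsymmx /\ forall v : 'rV[C]_n, 0 <= (v *m A *m v ^t*) 0 0.

Definition density n (A : 'M[C]_n) : Prop := psd A /\ \tr A = 1.

(* The computational basis of (C^2)^{(x) V} is indexed by the bit strings
   x : {ffun V -> 'I_2}; matrices being indexed by ordinals, the bit strings are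
   numbered by [enum_val]. *)
Local Notation bitstring := {ffun V -> 'I_2}.
Definition operator : Type := 'M[C]_#|{: bitstring}|.

Definition bits (k : 'I_#|{: bitstring}|) : bitstring := enum_val k.

Definition tensor (A : V -> 'M[C]_2) : operator :=
  \matrix_(k, l) \prod_i A i (bits k i) (bits l i).

Definition on_qubit (i : V) (A : 'M[C]_2) : operator :=
  tensor (fun k => if k == i then A else 1%:M).

Definition ketbra0 : 'M[C]_2 := delta_mx 0 0.
Definition ketbra1 : 'M[C]_2 := delta_mx 1 1.
Definition pauliZ : 'M[C]_2 := ketbra0 - ketbra1.

Definition proj00 (i j : V) : operator :=
  tensor (fun k => if (k == i) || (k == j) then ketbra0 else 1%:M).

Definition rank1_projector (A : 'M[C]_2) : Prop :=
  [/\ A \is hermsymmx, A *m A = A & \rank A = 1%N].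

(* In R[i], z <= 0 means that z is real and non-positive. *)
Definition stoquastic (H : operator) : Prop :=
  forall k l, k != l -> H k l <= 0.

Definition hamiltonian (c : V -> R) (phi : V -> 'M[C]_2) : operator :=
  \sum_i (c i)%:C *: on_qubit i (phi i).

End Qubits.

Record tvc (R : realType) (V : finType) (G : sgraph V) := TVC {
  coef : V -> R;
  proj : V -> 'M[R[i]]_2;
  coef_ge0 : forall i, 0 <= coef i;
  proj_rank1 : forall i, rank1_projector (proj i);
  trZ_le0 : forall i, \tr (pauliZ R *m proj i) <= 0;
  tvc_stoquastic : stoquastic (hamiltonian coef proj) }.

Section TransverseVertexCover.
Variables (R : realType) (V : finType) (G : sgraph V).

Definition feasible (rho : operator R V) : Prop :=
  density rho /\ forall i j, G i j -> \tr (proj00 R i j *m rho) = 0.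

Definition energy (P : tvc R G) (rho : operator R V) : R :=
  complex.Re (\tr (hamiltonian (coef P) (proj P) *m rho)).

(* The minimum over the feasible states: the set below is nonempty (it contains
   the energy of |1...1><1...1|) and bounded below by 0, and the feasible set is
   compact, so that its infimum is attained. *)
Definition mu_star (P : tvc R G) : R :=
  inf [set energy P rho | rho in feasible]%classic.

End TransverseVertexCover.

(* The local ratio algorithm, as a nondeterministic machine.  The program counter
   carries the part of the current loop that is still to be run, so that one
   transition does a bounded number of elementary operations (arithmetic
   operations, comparisons, memory accesses on V, accesses to the front of a
   list); the number of transitions is the running time.
   - [Mark s]:   vertices s still to be tested for a zero coefficient;
   - [Scan s F]: edges s still to be tested, F being the admissible edges found;
   - [Update e]: subtract the minimum coefficient on the chosen edge e;
   - [Fill s]:   vertices s still to be tested for a positive coefficient. *)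
Section Algorithm.
Variables (R : realType) (V : finType) (G : sgraph V) (P : tvc R G).
Local Notation C := R[i].

Inductive pc :=
  | Mark of seq V
  | Scan of seq (V * V) & seq (V * V)
  | Update of V * V
  | Fill of seq V
  | Halt.

Record state := State {
  at_pc : pc;
  cur : {ffun V -> R};
  out : {ffun V -> option 'M[C]_2} }.

(* Every undirected edge ij is listed as (i, j) and as (j, i). *)
Definition arcs : seq (V * V) := enum [pred e : V * V | G e.1 e.2].

Definition init : state :=
  State (Mark (enum V)) [ffun i => coef P i] [ffun=> None].

Definition set_out (o : {ffun V -> option 'M[C]_2}) (i : V) (A : 'M[C]_2) :=
  [ffun k => if k == i then Some A else o k].

Definition admissible (c : {ffun V -> R}) (e : V * V) : bool :=
  0 < Num.min (c e.1) (c e.2).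

Definition subtract_min (c : {ffun V -> R}) (e : V * V) : {ffun V -> R} :=
  let w := Num.min (c e.1) (c e.2) in
  [ffun k => if (k == e.1) || (k == e.2) then c k - w else c k].

Inductive step : state -> state -> Prop :=
  | StepMark i s c o :
      step (State (Mark (i :: s)) c o)
           (State (Mark s) c (if c i == 0 then set_out o i (ketbra1 R) else o))
  | StepMarkEnd c o :
      step (State (Mark [::]) c o) (State (Scan arcs [::]) c o)
  | StepScan e s F c o :
      step (State (Scan (e :: s) F) c o)
           (State (Scan s (if admissible c e then e :: F else F)) c o)
  | StepChoose e F c o : e \in F ->
      step (State (Scan [::] F) c o) (State (Update e) c o)
  | StepNoEdge c o :
      step (State (Scan [::] [::]) c o) (State (Fill (enum V)) c o)
  | StepUpdate e c o :
      step (State (Update e) c o) (State (Mark (enum V)) (subtract_min c e) o)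
  | StepFill i s c o :
      step (State (Fill (i :: s)) c o)
           (State (Fill s) c
                  (if 0 < c i then set_out o i (1%:M - proj P i) else o))
  | StepFillEnd c o :
      step (State (Fill [::]) c o) (State Halt c o).

Inductive execution : nat -> state -> Prop :=
  | ExecInit : execution 0 init
  | ExecStep t s s' : execution t s -> step s s' -> execution t.+1 s'.

Definition halted (s : state) : Prop := at_pc s = Halt.

End Algorithm.

(* Binary encoding lengths.  For instances with data in Q[i], polynomial time on
   a Turing machine follows from a polynomial number of elementary operations
   together with a polynomial bound on the length of every number stored. *)
Section Encoding.
Variable R : realType.

Definition nat_bits (n : nat) : nat := (trunc_log 2 n).+1.

Definition rat_bits (a : rat) : nat :=
  (nat_bits `|numq a| + nat_bits `|denq a|).+1.

Definition has_bits (z : R[i]) (k : nat) : Prop :=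
  exists a b : rat, z = ratr a +i* ratr b /\ k = (rat_bits a + rat_bits b)%N.

Definition bits_le (z : R[i]) (k : nat) : Prop :=
  exists2 l, has_bits z l & (l <= k)%N.

Variables (V : finType) (G : sgraph V).

Definition encoding_length (P : tvc R G) (L : nat) : Prop :=
  exists (lc : V -> nat) (lp : V -> 'I_2 -> 'I_2 -> nat),
    [/\ forall i, has_bits (coef P i)%:C (lc i),
        forall i a b, has_bits (proj P i a b) (lp i a b)
      & L = (#|V| + #|edges G|
             + \sum_i (lc i + \sum_a \sum_b lp i a b))%N].

Definition state_bits_le (s : state R V) (k : nat) : Prop :=
  (forall i, bits_le (cur s i)%:C k) /\
  (forall i A, out s i = Some A -> forall a b, bits_le (A a b) k).

End Encoding.

(* Main.v *)
(** Write a_i = <1|phi_i|1>; the hypothesis on Tr[Z phi_i] says a_i >= 1/2.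
    For an edge ij and a state with no weight on |00>_ij, each off-diagonal term
    of phi_i couples only |01> with |11>, and positivity of the state bounds it
    by AM-GM against the diagonal; with suitable weights this gives
      a_i + a_j <= (2 + sqrt 2) Tr[(phi_i + phi_j) rho].
    Each update of the algorithm moves a multiple of phi_i + phi_j out of H, so
    the inequality adds up to sum_i (c_i - c'_i) a_i <= (2 + sqrt 2) Tr[(H - H') rho]
    for every feasible rho, H' = sum_i c'_i phi_i being what is left at the end.
    The output pays at most a_i on qubit i for the removed part, and nothing for
    H'.  Each update also makes a positive coefficient vanish, and all the
    coefficients stay multiples of 1/D, D a common denominator of the inputs. *)

Require Import Defs.
From mathcomp Require Import all_boot all_order all_algebra.
From mathcomp Require Import sesquilinear spectral complex.
From mathcomp Require Import classical_sets reals.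
From mathcomp Require Import ring lra zify.

Set Implicit Arguments.
Unset Strict Implicit.
Unset Printing Implicit Defensive.

Import Order.TTheory GRing.Theory Num.Theory.

Local Open Scope ring_scope.
Local Open Scope sesquilinear_scope.

Local Notation "x %:C" := (real_complex _ x) (format "x %:C") : ring_scope.

(** * Positive semidefinite matrices: bounds on off-diagonal entries *)

Section Psd.
Variable R : realType.
Local Notation C := R[i].

Lemma conjR (x : R) : Num.conj (x%:C : C) = x%:C.
Proof. exact: conjc_real. Qed.

Lemma conjM (x y : C) : (x * y)^* = x^* * y^*.
Proof. exact: rmorphM. Qed.

Lemma conjN (x : C) : (- x)^* = - x^*.
Proof. exact: rmorphN. Qed.

Lemma hermP n (A : 'M[C]_n) :
  A \is hermsymmx -> forall k l, A l k = (A k l)^*.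
Proof.
move/is_hermitianmxP; rewrite expr0 scale1r => AE k l.
by rewrite {1}AE !mxE.
Qed.

Lemma hermE n (A : 'M[C]_n) :
  (forall k l, A l k = (A k l)^*) -> A \is hermsymmx.
Proof.
move=> AE; apply/is_hermitianmxP; rewrite expr0 scale1r.
by apply/matrixP => k l; rewrite !mxE AE.
Qed.

Lemma psd_diag n (A : 'M[C]_n) k : psd A -> 0 <= A k k.
Proof.
move=> [_ /(_ (delta_mx 0 k))].
rewrite -rowE mxE (bigD1 k) //= !mxE !eqxx /= rmorph1 mulr1.
by rewrite big1 ?addr0 // => l /negbTE lk; rewrite !mxE lk andbF rmorph0 mulr0.
Qed.

(** The quadratic form of [A] at the vector with entries [b] at [k], [d] at [l] and 0 elsewhere. *)
Lemma psd_form2 n (A : 'M[C]_n) k l (b d : C) : k != l -> psd A ->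
  0 <= b * b^* * A k k + b * d^* * A k l + d * b^* * A l k + d * d^* * A l l.
Proof.
move=> kl [_ /(_ (b *: delta_mx 0 k + d *: delta_mx 0 l))].
rewrite mulmxDl -!scalemxAl -!rowE !mxE (bigD1 k) //= (bigD1 l) ?(eq_sym l) //=.
rewrite !mxE !eqxx (negbTE kl) eq_sym (negbTE kl) /=.
rewrite big1 => [|m /andP[/negbTE mk /negbTE ml]]; last first.
  by rewrite !mxE mk ml /= !mulr0 addr0 rmorph0 mulr0.
rewrite !mulr1 !mulr0 !addr0 !add0r.
set z := (X in 0 <= X) => z0; set y := (X in 0 <= X).
by have -> : y = z by rewrite /y /z; ring.
Qed.

(** AM-GM in weighted form: for [t > 0] it is [psd_form2] at the entries [t] and [b], divided by
    [t]; for [t = 0] also [b = 0], and only the diagonal term in [u] remains. *)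
Lemma psd_pair n (A : 'M[C]_n) k l (t u : R) (b : C) : k != l -> psd A ->
  0 <= t -> 0 <= u -> b * b^* = (t * u)%:C ->
  0 <= t%:C * A k k + u%:C * A l l + b * A l k + b^* * A k l.
Proof.
move=> kl pA; rewrite le_eqVlt => /predU1P[<- u0 /eqP|t0 u0 bb].
  rewrite mul0r mulf_eq0 fmorph_eq0 orbb => /eqP ->.
  by rewrite !rmorph0 !mul0r add0r !addr0 mulr_ge0 ?ler0c ?psd_diag.
have := psd_form2 t%:C b kl pA; rewrite bb.
rewrite conjR.
have tC : 0 < t%:C :> C by rewrite ltcR.
rewrite rmorphM /= => H; rewrite -(pmulr_rge0 _ tC).
by apply: le_trans H _; rewrite le_eqVlt; apply/orP; left; apply/eqP; ring.
Qed.

(** With [A k k = 0] the weight [t] of [psd_pair] costs nothing, so [b] may be an arbitrarily large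
    negative multiple of [A k l]; a nonzero entry would make the form negative. *)
Lemma psd_diag0 n (A : 'M[C]_n) k l : psd A -> A k k = 0 -> A k l = 0.
Proof.
move=> pA Akk; have [<- //|kl] := eqVneq k l.
apply/eqP/negP => /negP nz.
have ll := psd_diag l pA.
have lr : A l l = (complex.Re (A l l))%:C by rewrite RRe_real // ger0_real.
set w := complex.Re (A l l) in lr.
have w0 : 0 <= w by rewrite -ler0c -lr.
have zr : (complex.Re (A k l * (A k l)^*))%:C = A k l * (A k l)^*.
  by rewrite RRe_real // ger0_real ?mul_conjC_ge0.
set z := complex.Re _ in zr.
have z0 : 0 < z by rewrite -ltcR zr lt_def mul_conjC_ge0 mul_conjC_eq0 nz.
(* [psd_pair] below gives [2 * s * z <= w], which this [s] contradicts. *)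
set s := ((w + 1) / z).
have sc := conjR s.
have t0 : 0 <= s ^+ 2 * z by rewrite mulr_ge0 ?sqr_ge0 ?(ltW z0).
have bb : - s%:C * A k l * (- s%:C * A k l)^* = (s ^+ 2 * z * 1)%:C.
  by rewrite conjM conjN sc mulr1 expr2 !rmorphM /= zr; ring.
have := psd_pair kl pA t0 ler01 bb.
rewrite Akk mulr0 add0r (hermP (proj1 pA) k l) lr conjM conjN sc.
have -> : 1%:C * w%:C + - s%:C * A k l * (A k l)^* + - s%:C * (A k l)^* * A k l
   = (w - 2 * (s * z))%:C.
  by rewrite rmorphB !rmorphM /= zr rmorph1 rmorphD rmorph1; ring.
rewrite ler0c /s mulfVK ?gt_eqF //; lra.
Qed.

End Psd.

(** * Operators on the qubits, with entries indexed by bit strings *)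

Section Operators.
Variables (R : realType) (V : finType).
Local Notation C := R[i].
Local Notation bitstring := {ffun V -> 'I_2}.
Implicit Types (x y : bitstring) (rho : operator R V) (i j : V).

Definition entry rho x y : C := rho (enum_rank x) (enum_rank y).

Lemma sum_enum_rank (F : 'I_#|{: bitstring}| -> C) :
  \sum_k F k = \sum_x F (enum_rank x).
Proof. by rewrite (reindex enum_rank) //; apply/onW_bij/enum_rank_bij. Qed.

Lemma entry_tensor (A : V -> 'M[C]_2) x y :
  entry (tensor A) x y = \prod_i A i (x i) (y i).
Proof. by rewrite /entry mxE; apply: eq_bigr => i _; rewrite /bits !enum_rankK. Qed.

Lemma trM_entry rho sigma :
  \tr (rho *m sigma) = \sum_x \sum_y entry rho x y * entry sigma y x.
Proof.
rewrite /mxtrace sum_enum_rank; apply: eq_bigr => x _.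
by rewrite mxE sum_enum_rank.
Qed.

(** The sum over the intermediate bit string factors into one sum per qubit. *)
Lemma tensorM (A B : V -> 'M[C]_2) :
  tensor A *m tensor B = tensor (fun i => A i *m B i).
Proof.
apply/matrixP => k l; rewrite [LHS]mxE [RHS]mxE sum_enum_rank.
have E x : tensor A k (enum_rank x) * tensor B (enum_rank x) l =
    \prod_i (A i (bits k i) (x i) * B i (x i) (bits l i)).
  rewrite !mxE -big_split; apply: eq_bigr => i _.
  by rewrite {2 3}/bits enum_rankK.
rewrite (eq_bigr _ (fun x _ => E x)).
rewrite -(bigA_distr_bigA (fun i a => A i (bits k i) a * B i a (bits l i))).
by apply: eq_bigr => i _; rewrite mxE.
Qed.

Lemma tr_tensor (A : V -> 'M[C]_2) : \tr (tensor A) = \prod_i \tr (A i).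
Proof.
rewrite /mxtrace sum_enum_rank bigA_distr_bigA; apply: eq_bigr => x _.
exact: entry_tensor.
Qed.

Lemma tensor_herm (A : V -> 'M[C]_2) :
  (forall i, A i \is hermsymmx) -> tensor A \is hermsymmx.
Proof.
move=> hA; apply: hermE => k l; rewrite !mxE rmorph_prod /=.
by apply: eq_bigr => i _; rewrite (hermP (hA i)).
Qed.

(** The form at [v] is the squared norm of [v *m A]. *)
Lemma psd_idempotent n (A : 'M[C]_n) : A \is hermsymmx -> A *m A = A -> psd A.
Proof.
move=> hA AA; split=> // v; rewrite -AA.
have -> : v *m (A *m A) *m v ^t* = (v *m A) *m (v *m A) ^t*.
  rewrite trmx_mul map_mxM !mulmxA; congr (_ *m _ *m _).
  by apply/matrixP => k l; rewrite !mxE (hermP hA).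
by rewrite mxE; apply: sumr_ge0 => k _; rewrite !mxE mul_conjC_ge0.
Qed.

Lemma ord2E (a : 'I_2) : a = if a == 0 then 0 else 1.
Proof. by case: a => [[|[|//]] ?]; apply/val_inj. Qed.

Lemma rev_ord2 (a : 'I_2) : rev_ord a = if a == 0 then 1 else 0.
Proof. by case: a => [[|[|//]] ?]; apply/val_inj. Qed.

Definition flip i x : bitstring := [ffun k => if k == i then rev_ord (x k) else x k].

Lemma flipK i : involutive (flip i).
Proof.
by move=> x; apply/ffunP => k; rewrite !ffunE; case: eqP; rewrite ?rev_ordK.
Qed.

Lemma flip_eq i x : flip i x i = rev_ord (x i).
Proof. by rewrite ffunE eqxx. Qed.

Lemma flip_neq i j x : j != i -> flip i x j = x j.
Proof. by rewrite ffunE => /negbTE ->. Qed.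

Lemma flip_neq_id i x : flip i x != x.
Proof.
apply/eqP => /ffunP/(_ i); rewrite flip_eq rev_ord2.
by case: eqVneq => [-> //|x0 e]; rewrite -e eqxx in x0.
Qed.

(** Groups the bit strings into the pairs that an operator on qubit [i] couples, each represented by
    its member with bit [i] equal to 0. *)
Lemma sum_flip i (F : bitstring -> C) :
  \sum_x F x = \sum_(x : bitstring | x i == 0) (F x + F (flip i x)).
Proof.
rewrite (bigID (fun x : bitstring => x i == 0)) big_split /=; congr (_ + _).
rewrite (reindex_inj (inv_inj (@flipK i))); apply: eq_bigl => x.
by rewrite flip_eq rev_ord2; case: (x i == 0).
Qed.

Lemma entry_on_qubit i (A : 'M[C]_2) x y :
  entry (on_qubit i A) x y =
  if [forall k, (k != i) ==> (x k == y k)] then A (x i) (y i) else 0.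
Proof.
rewrite entry_tensor (bigD1 i) //= eqxx; case: ifPn => [/forallP xy|].
  rewrite big1 ?mulr1 // => k ki; have := xy k; rewrite ki /= => /eqP ->.
  by rewrite (negbTE ki) mxE eqxx.
rewrite negb_forall => /existsP[k]; rewrite negb_imply => /andP[ki xyk].
by rewrite (bigD1 k) //= (negbTE ki) mxE (negbTE xyk) mul0r mulr0.
Qed.

Lemma tr_on_qubit i (A : 'M[C]_2) rho :
  \tr (on_qubit i A *m rho) =
  \sum_(x : bitstring | x i == 0)
    (A 0 0 * entry rho x x + A 1 1 * entry rho (flip i x) (flip i x)
     + A 0 1 * entry rho (flip i x) x + A 1 0 * entry rho x (flip i x)).
Proof.
rewrite trM_entry.
have diag x : \sum_y entry (on_qubit i A) x y * entry rho y x =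
    A (x i) (x i) * entry rho x x
    + A (x i) (rev_ord (x i)) * entry rho (flip i x) x.
  rewrite (bigD1 x) //= (bigD1 (flip i x)) ?flip_neq_id //= big1 ?addr0.
    rewrite !entry_on_qubit flip_eq !ifT //.
      by apply/forallP => k; apply/implyP => ki; rewrite flip_neq.
    by apply/forallP => k; apply/implyP.
  (* A [y] that agrees with [x] off qubit [i] is [x] or [flip i x], both excluded here. *)
  move=> y /andP[yx yfx]; rewrite entry_on_qubit ifF ?mul0r //.
  apply/negbTE/negP => /forallP xy.
  case: (eqVneq (y i) (x i)) => [yi|yi].
    case/eqP: yx; apply/ffunP => k; have [->//|ki] := eqVneq k i.
    by have := xy k; rewrite ki => /eqP.
  case/eqP: yfx; apply/ffunP => k; have [->|ki] := eqVneq k i.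
    rewrite flip_eq rev_ord2 (ord2E (y i)); move: yi.
    by rewrite (ord2E (y i)) (ord2E (x i)); do 2!case: (_ == 0).
  by rewrite flip_neq //; have := xy k; rewrite ki => /eqP.
under eq_bigr => x _ do rewrite diag.
rewrite (sum_flip i); apply: eq_bigr => x /eqP xi.
rewrite !flip_eq flipK xi !rev_ord2 /=; ring.
Qed.

Lemma psd_entry_ge0 rho x : psd rho -> 0 <= entry rho x x.
Proof. exact: psd_diag. Qed.

(* On each pair [x, flip i x], the off-diagonal part of [A] is absorbed by
   [psd_pair] with weights [t], [u], or vanishes with [entry rho x x]. *)
Lemma tr_on_qubit_ge i (A : 'M[C]_2) (a : R) rho (h : bitstring -> R) :
  psd rho -> A \is hermsymmx -> A 0 0 = (1 - a)%:C -> A 1 1 = a%:C ->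
  A 0 1 * (A 0 1)^* = ((1 - a) * a)%:C ->
  (forall x, x i = 0 ->
     (exists t u, [/\ 0 <= t, 0 <= u, t * u = (1 - a) * a,
        h x = 1 - a - t & h (flip i x) = a - u])
     \/ entry rho x x = 0 /\ h (flip i x) = a) ->
  \sum_x (h x)%:C * entry rho x x <= \tr (on_qubit i A *m rho).
Proof.
move=> prho hA A00 A11 A01 hh.
rewrite (sum_flip i) tr_on_qubit; apply: ler_sum => x /eqP xi.
rewrite A00 A11 (hermP hA 0 1).
case: (hh x xi) => [[t [u [t0 u0 tu -> ->]]]|[r0 ->]].
  have kl : enum_rank x != enum_rank (flip i x).
    by rewrite (inj_eq enum_rank_inj) eq_sym flip_neq_id.
  have := psd_pair kl prho t0 u0; rewrite tu => /(_ _ A01).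
  rewrite -/(entry rho _ _) -subr_ge0 => H; rewrite -subr_ge0.
  apply: le_trans H _; rewrite le_eqVlt; apply/orP; left; apply/eqP.
  by rewrite !rmorphB /= /entry; ring.
have r1 : entry rho x (flip i x) = 0 by apply: (psd_diag0 _ prho r0).
have r2 : entry rho (flip i x) x = 0.
  by rewrite /entry (hermP (proj1 prho) (enum_rank x)) -/(entry rho _ _) r1 rmorph0.
by rewrite r0 r1 r2 !mulr0 add0r !addr0.
Qed.

Lemma entry_proj00 i j x y : entry (proj00 R i j) x y =
  ((x == y) && (x i == 0) && (x j == 0))%:R.
Proof.
rewrite entry_tensor; case: eqVneq => [<-|xy] /=; last first.
  have [k xyk] : exists k, x k != y k.
    by apply/existsP; apply: contraNT xy; rewrite negb_exists => /forallP xy;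
      apply/eqP/ffunP => k; apply/eqP; have := xy k; rewrite negbK.
  rewrite (bigD1 k) //=; case: ifP => _; rewrite mxE ?(negbTE xyk) ?mul0r //.
  have [xk|] := eqVneq (x k) 0; last by rewrite mul0r.
  by rewrite eq_sym -xk (negbTE xyk) mul0r.
have [xi|xi] := eqVneq (x i) 0; last first.
  by rewrite (bigD1 i) //= eqxx mxE (negbTE xi) mul0r.
have [xj|xj] := eqVneq (x j) 0; last first.
  by rewrite (bigD1 j) //= eqxx orbT mxE (negbTE xj) mul0r.
apply: big1 => k _; case: ifP => [/orP[] /eqP ->|]; by rewrite mxE ?xi ?xj ?eqxx.
Qed.

(** The trace is a sum of diagonal entries of [rho], all nonnegative, so each of them vanishes with
    it. *)
Lemma proj00_eq0 i j rho x : psd rho -> \tr (proj00 R i j *m rho) = 0 ->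
  x i = 0 -> x j = 0 -> entry rho x x = 0.
Proof.
move=> prho; rewrite trM_entry.
under eq_bigr => y _.
  rewrite (bigD1 y) //= big1 ?addr0 => [|z /negbTE zy]; last first.
    by rewrite entry_proj00 eq_sym zy mul0r.
  rewrite entry_proj00 eqxx /=; over.
move=> s0 xi xj.
have ge0 y : true -> 0 <= ((y i == 0) && (y j == 0))%:R * entry rho y y.
  by move=> _; rewrite mulr_ge0 ?ler0n ?psd_entry_ge0.
by have := psumr_eq0P ge0 s0 isT; move=> /(_ x); rewrite xi xj !eqxx mul1r; apply.
Qed.

End Operators.

(** * Rank-1 projectors on one qubit *)

Section Projectors.
Variable R : realType.
Local Notation C := R[i].
Implicit Types A : 'M[C]_2.

Lemma lift0_ord2 : lift ord0 ord0 = 1 :> 'I_2.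
Proof. exact: val_inj. Qed.

Lemma tr2 A : \tr A = A 0 0 + A 1 1.
Proof. by rewrite /mxtrace !big_ord_recl big_ord0 addr0 lift0_ord2. Qed.

Lemma mul2E A (B : 'M[C]_2) k l : (A *m B) k l = A k 0 * B 0 l + A k 1 * B 1 l.
Proof.
by rewrite mxE !big_ord_recl big_ord0 addr0 lift0_ord2.
Qed.

Lemma ker2 A : \rank A = 1%N -> exists2 v : 'rV[C]_2, v != 0 & v *m A = 0.
Proof.
move=> rA; have /rowV0Pn[v /sub_kermxP vA v0] : kermx A != 0.
  by rewrite -mxrank_eq0 mxrank_ker rA.
by exists v.
Qed.

(** A nonzero left kernel vector makes the rows dependent; one of its nonzero coordinates is then
    cancelled. *)
Lemma det2_eq0 A : \rank A = 1%N -> A 0 0 * A 1 1 = A 0 1 * A 1 0.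
Proof.
move=> /ker2[v v0 vA].
have E l : v 0 0 * A 0 l + v 0 1 * A 1 l = 0.
  have /matrixP/(_ 0 l) := vA; by rewrite !mxE !big_ord_recl big_ord0 addr0 lift0_ord2.
have [v00|nz] := eqVneq (v 0 0) 0; last first.
  apply: (mulfI nz); have := E 0; have := E 1 => /eqP; rewrite addr_eq0 => /eqP e1.
  move=> /eqP; rewrite addr_eq0 => /eqP e0.
  by rewrite !mulrA e0 e1; ring.
have nz : v 0 1 != 0.
  apply: contra_neq v0 => v01; apply/rowP => k.
  by rewrite mxE (ord2E k); case: ifP.
apply: (mulfI nz); have := E 0; have := E 1; rewrite v00 !mul0r !add0r => e1 e0.
by rewrite mulrCA e1 [in RHS]mulrCA e0 !mulr0.
Qed.

(** By Cayley-Hamilton with zero determinant, [A *m A] is [\tr A] times [A]; it is also [A], which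
    is nonzero. *)
Lemma tr_rank1_projector A : rank1_projector A -> \tr A = 1.
Proof.
move=> [_ AA rA]; have dA := det2_eq0 rA.
have AE k l : A k l * \tr A = A k l.
  rewrite tr2 -[RHS](congr1 (fun B : 'M_2 => B k l) AA) mul2E mulrDr.
  rewrite (ord2E k) (ord2E l); case: (k == 0); case: (l == 0).
  - by rewrite dA.
  - ring.
  - ring.
  - by rewrite [A 1 1 * A 0 0]mulrC dA; ring.
apply/eqP/negP => /negP t1.
have A0 : A = 0.
  apply/matrixP => k l; rewrite mxE; apply/eqP; move: t1; apply: contraNT => nz.
  by apply/eqP/(mulfI nz); rewrite AE mulr1.
by move: rA; rewrite A0 mxrank0.
Qed.

Definition weight1 A : R := complex.Re (A 1 1).

(** Trace 1 gives the diagonal and determinant 0 the modulus of the off-diagonal entry. The trace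
    against [pauliZ] is [1 - 2a], whence the lower bound on [a]; the upper one is [0 <= A 0 0]. *)
Lemma proj_entries A : rank1_projector A -> \tr (pauliZ R *m A) <= 0 ->
  let a := weight1 A in
  [/\ A 0 0 = (1 - a)%:C, A 1 1 = a%:C, A 0 1 * (A 0 1)^* = ((1 - a) * a)%:C,
      1 / 2 <= a & a <= 1].
Proof.
move=> prA; have := tr_rank1_projector prA.
case: prA => hA AA rA; rewrite tr2 => trA.
have pA : psd A := psd_idempotent hA AA.
have A11 : A 1 1 = (weight1 A)%:C by rewrite RRe_real // ger0_real ?psd_diag.
have A00 : A 0 0 = (1 - weight1 A)%:C.
  by rewrite rmorphB rmorph1 /= -A11 -trA addrK.
rewrite tr2 !mul2E !mxE /= !(mulr0, mulr1, mul0r, mul1r, subr0, addr0, add0r, sub0r).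
rewrite mulN1r A00 A11 -rmorphB lecR => Z; split=> //.
- by rewrite -(hermP hA) -(det2_eq0 rA) A00 A11 rmorphM.
- lra.
- by have := psd_diag 0 pA; rewrite A00 ler0c subr_ge0.
Qed.

(** Makes [1%:M - A] a qubit state of zero energy for [A]; its trace is 2 - 1. *)
Lemma rank1_projector_compl A : rank1_projector A ->
  [/\ (1%:M - A) \is hermsymmx, (1%:M - A) *m (1%:M - A) = 1%:M - A,
      \tr (1%:M - A) = 1 & \tr (A *m (1%:M - A)) = 0].
Proof.
move=> prA; have trA := tr_rank1_projector prA; case: prA => hA AA _.
have A0 : A *m (1%:M - A) = 0 by rewrite mulmxBr mulmx1 AA subrr.
split.
- apply: hermE => k l; rewrite !mxE (hermP hA k l) eq_sym rmorphB /=.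
  by rewrite rmorph_nat.
- by rewrite mulmxBl mul1mx A0 subr0.
- by rewrite raddfB /= mxtrace1 trA; ring.
- by rewrite A0 mxtrace0.
Qed.

Lemma ketbra1_facts :
  [/\ ketbra1 R \is hermsymmx, ketbra1 R *m ketbra1 R = ketbra1 R,
      \tr (ketbra1 R) = 1, \tr (ketbra0 R *m ketbra1 R) = 0
    & forall A, \tr (A *m ketbra1 R) = A 1 1].
Proof.
split.
- by apply: hermE => k l; rewrite !mxE rmorph_nat andbC.
- by rewrite /ketbra1 mul_delta_mx.
- by rewrite tr2 !mxE /= add0r.
- by rewrite mul_delta_mx_0 // mxtrace0.
- by move=> A; rewrite tr2 !mul2E !mxE /= !mulr0 mulr1 !add0r.
Qed.

End Projectors.

(** * Local energies and the inequality on an edge *)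

Section LocalEnergies.
Variables (R : realType) (V : finType) (G : sgraph V) (P : tvc R G).
Local Notation C := R[i].
Local Notation bitstring := {ffun V -> 'I_2}.
Implicit Types (rho : operator R V) (i j : V) (x : bitstring).

Lemma Re_sum (I : finType) (F : I -> C) :
  complex.Re (\sum_i F i) = \sum_i complex.Re (F i).
Proof. by apply: (big_morph (@complex.Re R)) => // [[? ?] [? ?]]. Qed.

Lemma ReZ (c : R) (z : C) : complex.Re (c%:C * z) = c * complex.Re z.
Proof. by case: z => u v /=; rewrite mul0r subr0. Qed.

Lemma ler_Re (y z : C) : y <= z -> complex.Re y <= complex.Re z.
Proof. by rewrite lecE => /andP[]. Qed.

Definition weight i : R := weight1 (proj P i).

Definition local_energy rho i : R := complex.Re (\tr (on_qubit i (proj P i) *m rho)).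

Definition population rho (x : bitstring) : R := complex.Re (entry rho x x).

Lemma energyE rho : energy P rho = \sum_i coef P i * local_energy rho i.
Proof.
rewrite /energy /hamiltonian mulmx_suml (linear_sum (@mxtrace C _)) /= Re_sum.
apply: eq_bigr => i _.
by rewrite -scalemxAl /= mxtraceZ ReZ.
Qed.

Lemma weight_bounds i : 1 / 2 <= weight i /\ weight i <= 1.
Proof. by have [] := proj_entries (proj_rank1 P i) (trZ_le0 P i). Qed.

Lemma population_ge0 rho x : psd rho -> 0 <= population rho x.
Proof. by move=> prho; rewrite /population (ler_Re (psd_entry_ge0 x prho)). Qed.

Lemma sum_population rho : density rho -> \sum_x population rho x = 1.
Proof.
move=> [_ trho]; rewrite -Re_sum (_ : \sum_x _ = 1) //.
by rewrite -trho /mxtrace sum_enum_rank.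
Qed.

Lemma local_energy_ge i rho (h : bitstring -> R) : psd rho ->
  (forall x, x i = 0 ->
     (exists t u, [/\ 0 <= t, 0 <= u, t * u = (1 - weight i) * weight i,
        h x = 1 - weight i - t & h (flip i x) = weight i - u])
     \/ population rho x = 0 /\ h (flip i x) = weight i) ->
  \sum_x h x * population rho x <= local_energy rho i.
Proof.
move=> prho hh; have [A00 A11 A01 _ _] := proj_entries (proj_rank1 P i) (trZ_le0 P i).
have [hA _ _] := proj_rank1 P i.
have hh' x : x i = 0 ->
     (exists t u, [/\ 0 <= t, 0 <= u, t * u = (1 - weight i) * weight i,
        h x = 1 - weight i - t & h (flip i x) = weight i - u])
     \/ entry rho x x = 0 /\ h (flip i x) = weight i.
  move=> /hh[H|[p0 H]]; [by left|right; split=> //].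
  by rewrite -[LHS]RRe_real ?ger0_real ?psd_entry_ge0 // -/(population rho x) p0.
have /ler_Re := tr_on_qubit_ge prho hA A00 A11 A01 hh'.
by rewrite Re_sum; under eq_bigr => x _ do rewrite ReZ.
Qed.

Lemma local_energy_ge0 i rho : psd rho -> 0 <= local_energy rho i.
Proof.
move=> prho; have [w0 w1] := weight_bounds i.
have := @local_energy_ge i rho (fun=> 0) prho.
rewrite big1 => [|x _]; last by rewrite mul0r.
(* These weights use up the diagonal exactly, which leaves [h = 0]. *)
apply=> x _; left; exists (1 - weight i), (weight i); rewrite !subrr; split=> //; lra.
Qed.

(* Comes from [t = sqrt 2 * (1 - a)] and [u = a / sqrt 2] in
   [local_energy_ge]; the value at [x i = x j = 0] is irrelevant, such [x] being
   unpopulated. *)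
Definition edge_coef i j (x : bitstring) : R :=
  if x i == 0 then (1 - weight i) * (1 - Num.sqrt 2)
  else if x j == 0 then weight i else weight i * (1 - Num.sqrt 2 / 2).

Lemma sqrt2_bounds : Num.sqrt 2 ^+ 2 = 2 :> R /\ 4 / 3 <= Num.sqrt 2 :> R.
Proof.
have s2 : Num.sqrt 2 ^+ 2 = 2 :> R by rewrite sqr_sqrtr // ler0n.
have s0 : 0 <= Num.sqrt 2 :> R := sqrtr_ge0 _.
split=> //; nra.
Qed.

(** If [x] reads 00 on the edge it is unpopulated, so [flip i x] keeps its full weight. On the other
    pairs [t * u] has the required value because [sqrt 2 ^ 2 / 2 = 1]. *)
Lemma local_energy_edge i j rho : i != j -> feasible G rho -> G i j ->
  \sum_x edge_coef i j x * population rho x <= local_energy rho i.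
Proof.
move=> ij [[prho trho] /(_ i j)] f Gij.
have [w0 w1] := weight_bounds i; have [s2 s0] := sqrt2_bounds.
apply: local_energy_ge => // x xi; rewrite /edge_coef flip_eq xi rev_ord2 eqxx /=.
rewrite flip_neq 1?eq_sym //; have [xj|xj] := eqVneq (x j) 0.
  by right; split=> //; rewrite /population (proj00_eq0 prho (f Gij)).
left; exists (Num.sqrt 2 * (1 - weight i)), (weight i * (Num.sqrt 2 / 2)); split.
- nra.
- nra.
- transitivity ((1 - weight i) * weight i * (Num.sqrt 2 ^+ 2 / 2)); first by field.
  by rewrite s2; field.
- ring.
- ring.
Qed.

Lemma edge_ratio i j rho : i != j -> feasible G rho -> G i j ->
  weight i + weight j <= (2 + Num.sqrt 2) * (local_energy rho i + local_energy rho j).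
Proof.
move=> ij frho Gij; have [s2 s0] := sqrt2_bounds.
have ei := local_energy_edge ij frho Gij.
have ej : \sum_x edge_coef j i x * population rho x <= local_energy rho j.
  by apply: local_energy_edge; rewrite 1?eq_sym // adj_sym.
have [a0 a1] := weight_bounds i; have [b0 b1] := weight_bounds j.
set a := weight i in a0 a1 *; set b := weight j in b0 b1 *.
(* [1 - sqrt 2 / 2] is the inverse of [2 + sqrt 2]. *)
suff H : (1 - Num.sqrt 2 / 2) * (a + b) <= local_energy rho i + local_energy rho j.
  have -> : a + b = (2 + Num.sqrt 2) * ((1 - Num.sqrt 2 / 2) * (a + b)).
    rewrite mulrA (_ : _ * (1 - _) = 2 - Num.sqrt 2 ^+ 2 / 2); last by field.
    by rewrite s2; field.
  by apply: ler_wpM2l => //; lra.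
apply: le_trans (lerD ei ej); rewrite -big_split /=.
(* The populations form a probability distribution, so the inequality may be checked on each bit
   string separately. *)
have expand (z : R) : z = \sum_x z * population rho x.
  by rewrite -mulr_sumr sum_population ?mulr1 //; case: frho.
rewrite [X in X <= _]expand.
apply: ler_sum => x _; rewrite -mulrDl.
have p0 := population_ge0 x (proj1 (proj1 frho)).
(* Right side minus left side is 1/2 of the product in [h1] plus 3/2 of the product in [h2]. *)
have prods (c d : R) : 1 / 2 <= c -> 1 / 2 <= d ->
    (1 - Num.sqrt 2 / 2) * (c + d) <= (1 - c) * (1 - Num.sqrt 2) + d.
  move=> c0 d0.
  have h1 : 0 <= (d - 1 / 2) * Num.sqrt 2 by apply: mulr_ge0; lra.
  have h2 : 0 <= (c - 1 / 2) * (Num.sqrt 2 - 4 / 3) by apply: mulr_ge0; lra.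
  lra.
(* On the edge, 00 is unpopulated, 01 and 10 follow from [prods], and 11 is an equality. *)
have [xi|xi] := eqVneq (x i) 0; have [xj|xj] := eqVneq (x j) 0.
- rewrite /population (proj00_eq0 (proj1 (proj1 frho)) (proj2 frho _ _ Gij)) //.
  by rewrite !mulr0.
- apply: ler_wpM2r => //; rewrite /edge_coef (negbTE xj) xi eqxx /= -/a -/b;
    have := prods a b a0 b0; lra.
- apply: ler_wpM2r => //; rewrite /edge_coef (negbTE xi) xj eqxx /= -/a -/b;
    have := prods b a b0 a0; lra.
- apply: ler_wpM2r => //; rewrite /edge_coef (negbTE xi) (negbTE xj) /= -/a -/b; lra.
Qed.

(** * Product states: feasibility and energy *)

Variable rho : V -> 'M[C]_2.
Hypotheses (rho_herm : forall i, rho i \is hermsymmx)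
  (rho_idem : forall i, rho i *m rho i = rho i) (rho_tr : forall i, \tr (rho i) = 1).

Lemma product_density : density (tensor rho).
Proof.
split; last by rewrite tr_tensor big1.
apply: psd_idempotent; first exact: tensor_herm.
rewrite tensorM; apply/matrixP => k l; rewrite !mxE.
by apply: eq_bigr => i _; rewrite rho_idem.
Qed.

Lemma product_feasible :
  (forall i j, G i j -> rho i = ketbra1 R \/ rho j = ketbra1 R) -> feasible G (tensor rho).
Proof.
move=> cover; split=> [|i j Gij]; first exact: product_density.
have [_ _ _ k01 _] := ketbra1_facts R.
rewrite /proj00 tensorM tr_tensor; case: (cover i j Gij) => rk.
  by rewrite (bigD1 i) //= eqxx rk k01 mul0r.
by rewrite (bigD1 j) //= eqxx orbT rk k01 mul0r.
Qed.

Lemma product_local_energy i :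
  local_energy (tensor rho) i = complex.Re (\tr (proj P i *m rho i)).
Proof.
rewrite /local_energy /on_qubit tensorM tr_tensor (bigD1 i) //= eqxx.
by rewrite big1 ?mulr1 // => k /negbTE ->; rewrite mul1mx.
Qed.

End LocalEnergies.

(** * Invariants of the algorithm *)

Section AlgorithmInvariants.
Variables (R : realType) (V : finType) (G : sgraph V) (P : tvc R G).
Implicit Types (c : {ffun V -> R}) (o : {ffun V -> option 'M[R[i]]_2}) (e : V * V).

Lemma adj_neq i j : G i j -> i != j.
Proof. by apply: contraTneq => ->; rewrite adj_irrefl. Qed.

(* The local ratio principle: an edgewise inequality between vertex weights
   extends to the part [coef P - c] of the coefficients already removed. *)
Definition local_ratio c : Prop :=
  (forall i, 0 <= c i <= coef P i) /\
  forall x y : V -> R, (forall i j, G i j -> x i + x j <= y i + y j) ->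
    \sum_i (coef P i - c i) * x i <= \sum_i (coef P i - c i) * y i.

Lemma subtract_minE c e i : subtract_min c e i =
  c i - (if (i == e.1) || (i == e.2) then Num.min (c e.1) (c e.2) else 0).
Proof. by rewrite ffunE; case: ifP; rewrite ?subr0. Qed.

Lemma subtract_min_bounds c e i : (forall k, 0 <= c k) ->
  0 <= subtract_min c e i <= c i.
Proof.
move=> c0; rewrite subtract_minE; case: ifP => [ie|_]; last by rewrite subr0 c0 lexx.
have w0 : 0 <= Num.min (c e.1) (c e.2) by rewrite le_min !c0.
rewrite subr_ge0 gerBl w0 andbT.
by case/orP: ie => /eqP ->; rewrite ge_min lexx ?orbT.
Qed.

Lemma sum_pair i j (x : V -> R) w : i != j ->
  \sum_k (if (k == i) || (k == j) then w else 0) * x k = w * (x i + x j).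
Proof.
move=> ij; rewrite (bigD1 i) //= (bigD1 j) 1?eq_sym //= !eqxx orbT big1.
  by rewrite addr0 mulrDr.
by move=> k /andP[/negbTE -> /negbTE ->]; rewrite mul0r.
Qed.

Lemma subtract_min_local_ratio c e :
  G e.1 e.2 -> local_ratio c -> local_ratio (subtract_min c e).
Proof.
move=> Ge [cb lr]; have c0 k : 0 <= c k by case/andP: (cb k).
split=> [i|x y xy].
  have /andP[-> h] := subtract_min_bounds e i c0.
  by apply: le_trans h _; case/andP: (cb i).
(* An update adds to either side the removed amount times the sum over the two endpoints, so the
   edge inequality scaled by that amount is what is added. *)
have E (z : V -> R) : \sum_i (coef P i - subtract_min c e i) * z i =
    \sum_i (coef P i - c i) * z i + Num.min (c e.1) (c e.2) * (z e.1 + z e.2).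
  rewrite -sum_pair ?adj_neq // -big_split /=; apply: eq_bigr => i _.
  by rewrite subtract_minE -mulrDl opprB addrCA addrC.
by rewrite !E lerD ?lr // ler_wpM2l ?xy // le_min !c0.
Qed.

Definition zeros_marked c o (s : seq V) : Prop :=
  forall i, i \notin s -> c i = 0 -> o i = Some (ketbra1 R).

Definition positives_filled c o (s : seq V) : Prop :=
  forall i, i \notin s -> 0 < c i -> o i = Some (1%:M - proj P i).

Definition no_admissible c : Prop := forall i j, G i j -> ~~ admissible c (i, j).

(** The list [s] holds what the current loop has still to visit. During a scan every admissible edge
    lies in [s ++ F], so an empty [F] at the end shows that none is left. *)
Definition pc_inv (p : pc V) c o : Prop :=
  match p with
  | Mark s => zeros_marked c o s
  | Scan s F => [/\ zeros_marked c o [::],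
      forall e, e \in s -> G e.1 e.2,
      forall e, e \in F -> G e.1 e.2 && admissible c e
    & forall e, G e.1 e.2 -> admissible c e -> e \in s ++ F]
  | Update e => zeros_marked c o [::] /\ G e.1 e.2 && admissible c e
  | Fill s => [/\ zeros_marked c o [::], no_admissible c & positives_filled c o s]
  | Halt => [/\ zeros_marked c o [::], no_admissible c & positives_filled c o [::]]
  end.

(** The last clause serves the bound on the length of the output entries. *)
Definition state_inv (s : state R V) : Prop :=
  [/\ local_ratio (cur s), pc_inv (at_pc s) (cur s) (out s)
    & forall i A, out s i = Some A -> A = ketbra1 R \/ A = 1%:M - proj P i].

Lemma state_inv_init : state_inv (init P).
Proof.
split=> /=.
- split=> [i|x y _]; first by rewrite ffunE coef_ge0 lexx.
  by rewrite !big1 // => i _; rewrite ffunE subrr mul0r.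
- by move=> i; rewrite mem_enum.
- by move=> i A; rewrite ffunE.
Qed.

Lemma state_inv_step s s' : step P s s' -> state_inv s -> state_inv s'.
Proof.
case=> {s s'}.
- move=> i s c o [/= lr zm oA]; split=> //=.
  + move=> k ks ck; have [ki|ki] := eqVneq k i.
      by rewrite -ki ck eqxx ffunE eqxx.
    have ok : o k = Some (ketbra1 R) by apply: zm; rewrite // inE (negbTE ki).
    by case: ifP => // _; rewrite ffunE (negbTE ki).
  + case: ifP => // _ k A; rewrite ffunE; case: eqP => [_ [<-]|_]; [by left|exact: oA].
- move=> c o [/= lr zm oA]; split=> //=; split=> //.
  + by move=> e; rewrite mem_enum inE.
  + by move=> e Ge _; rewrite cats0 mem_enum inE.
- move=> e s F c o [/= lr [zm sG FG all] oA]; split=> //=; split=> //.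
  + by move=> f fs; apply: sG; rewrite inE fs orbT.
  + case: ifP => // ae f; rewrite inE => /predU1P[->|]; last exact: FG.
    by rewrite ae sG // mem_head.
  + move=> f Gf af; have := all f Gf af; rewrite inE !mem_cat.
    case: ifP => [_|ae]; first by rewrite inE orbCA.
    by case: eqP => //= fe; rewrite -fe af in ae.
- by move=> e F c o eF [/= lr [zm sG FG all] oA]; split=> //=; split=> //; exact: FG.
- move=> c o [/= lr [zm sG FG all] oA]; split=> //=; split=> //.
  + by move=> i j Gij; apply/negP => /(all (i, j) Gij).
  + by move=> i; rewrite mem_enum.
- move=> e c o [/= lr [zm /andP[Ge _]] oA]; split=> //=.
  + exact: subtract_min_local_ratio.
  (* All vertices are pending again, so the claim on marked zeros is vacuous. *)
  + by move=> i; rewrite mem_enum.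
- move=> i s c o [/= lr [zm na pf] oA]; split=> //=.
    split=> // k ks ck; case: ifP => [ci|ci].
    (* Filling writes only where the coefficient is positive, hence never over a marked zero. *)
    + by rewrite ffunE; case: eqVneq => [ki|_]; [rewrite -ki ck ltxx in ci|exact: zm].
    + exact: zm.
    + rewrite ffunE; case: eqVneq => [->//|ki]; apply: pf => //.
      by rewrite inE (negbTE ki).
    + apply: pf => //; rewrite inE negb_or ks andbT.
      by apply: contraFN ci => /eqP <-.
  case: ifP => // _ k A; rewrite ffunE; case: eqP => [-> [<-]|_]; [by right|exact: oA].
- by move=> c o [].
Qed.

Lemma state_inv_execution t s : execution P t s -> state_inv s.
Proof.
elim=> [|{}t {}s s' _ IH st]; first exact: state_inv_init.
exact: state_inv_step IH.
Qed.

Lemma progress (s : state R V) : halted s \/ exists s', step P s s'.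
Proof.
case: s => p c o; case: p => [[|i s]|[|e s] [|f F]|e|[|i s]|].
all: try by left.
all: right; eexists.
- exact: StepMarkEnd.
- exact: StepMark.
- exact: StepNoEdge.
- by apply: StepChoose (mem_head _ _).
- exact: StepScan.
- exact: StepScan.
- exact: StepUpdate.
- exact: StepFillEnd.
- exact: StepFill.
Qed.

(** * Running time *)

Definition positives c : nat := #|[pred i | 0 < c i]|.

Lemma positives_subtract_min c e : (forall i, 0 <= c i) -> admissible c e ->
  (positives (subtract_min c e) < positives c)%N.
Proof.
move=> c0; rewrite /admissible lt_min => /andP[c1 c2]; apply/proper_card/properP.
split.
  apply/fintype.subsetP => i; rewrite !inE => h; apply: lt_le_trans h _.
  by have /andP[] := subtract_min_bounds e i c0.
(* The endpoint that attains the minimum drops to 0. *)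
have [le12|lt21] := leP (c e.1) (c e.2).
  by exists e.1; rewrite !inE // subtract_minE eqxx (min_idPl le12) subrr ltxx.
by exists e.2; rewrite !inE // subtract_minE eqxx orbT (min_idPr (ltW lt21)) subrr ltxx.
Qed.

(** Length of the last round: the vertices are marked and later filled, the arcs scanned, and three
    loops exited. A round with an update is no longer. *)
Definition round_time : nat := (2 * size (enum V) + size (arcs G) + 3)%N.

(* Every transition decreases this potential; an update spends a whole round
   because it lowers the number of positive coefficients. *)
Definition time_left (s : state R V) : nat :=
  let later := (positives (cur s) * round_time)%N in
  match at_pc s with
  | Mark s => later + (size s + size (enum V) + size (arcs G) + 3)
  | Scan s _ => later + (size s + size (enum V) + 2)
  | Update _ => later + 1
  | Fill s => size s + 1
  | Halt => 0
  end%N.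

Lemma time_left_step s s' : step P s s' -> state_inv s ->
  (time_left s' < time_left s)%N.
Proof.
case=> {s s'} /=.
- by move=> i s c o _; rewrite /time_left /=; lia.
- by move=> c o _; rewrite /time_left /=; lia.
- by move=> e s F c o _; rewrite /time_left /=; lia.
- by move=> e F c o _ _; rewrite /time_left /=; lia.
- by move=> c o _; rewrite /time_left /=; lia.
- move=> e c o [/= [cb _] [_ /andP[_ ae]] _]; rewrite /time_left /=.
  have c0 i : 0 <= c i by case/andP: (cb i).
  (* The lost positive coefficient releases one [round_time], exactly the potential of a fresh
     marking loop beyond the later rounds; the update itself spends the extra 1. *)
  have := positives_subtract_min c0 ae; rewrite -(leq_pmul2r (m := round_time)) //.
    rewrite mulSn; move: (_ * _)%N (positives c * _)%N => p' p.
    by rewrite /round_time; move: (size (enum V)) (size (arcs G)) => n m; lia.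
  by rewrite /round_time addn3.
- by move=> i s c o _; rewrite /time_left /=; lia.
- by move=> c o _; rewrite /time_left /=; lia.
Qed.

Lemma execution_time t s : execution P t s ->
  (t <= #|V|.+1 * (2 * #|V| + #|V| ^ 2 + 3))%N.
Proof.
move=> ex; suff : (t + time_left s <= time_left (init P))%N.
  have pV : (positives [ffun i => coef P i] <= #|V|)%N by exact: max_card.
  have aV : (size (arcs G) <= #|V| ^ 2)%N.
    by rewrite /arcs -cardE (leq_trans (max_card _)) // card_prod.
  rewrite /time_left /= /round_time => /(leq_trans (leq_addr _ _)).
  move: pV aV; rewrite cardE; move: (size (enum V)) (size (arcs G)) (positives _).
  move=> n m p pn mn H; apply: leq_trans H _.
  rewrite mulSn addnC leq_add //; first by lia.
  by apply: leq_mul => //; lia.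
elim: ex => [|{}t {}s s' ex IH st]; first by rewrite add0n.
have := time_left_step st (state_inv_execution ex); lia.
Qed.

End AlgorithmInvariants.

(** * The approximation ratio of the output *)

Section Approximation.
Variables (R : realType) (V : finType) (G : sgraph V) (P : tvc R G).

Lemma halted_output (s : state R V) : state_inv P s -> halted s ->
  exists rho : V -> 'M[R[i]]_2,
    [/\ forall i, out s i = Some (rho i), forall i, density (rho i),
        feasible G (tensor rho)
      & energy P (tensor rho) <= (2 + Num.sqrt 2) * mu_star P].
Proof.
rewrite /halted => -[[cb lr] inv _] pcE; move: inv; rewrite pcE => -[zm na pf].
have c0 i : 0 <= cur s i by case/andP: (cb i).
have [k1h k1i k1t _ k1e] := ketbra1_facts R.
have compl i := rank1_projector_compl (proj_rank1 P i).
pose rho i := if cur s i == 0 then ketbra1 R else 1%:M - proj P i.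
have rhoh i : rho i \is hermsymmx.
  by rewrite /rho; case: ifP => // _; have [] := compl i.
have rhoi i : rho i *m rho i = rho i.
  by rewrite /rho; case: ifP => // _; have [] := compl i.
have rhot i : \tr (rho i) = 1.
  by rewrite /rho; case: ifP => // _; have [] := compl i.
have frho : feasible G (tensor rho).
  apply: product_feasible => // i j Gij; rewrite /rho.
  have [ci|ci] := eqVneq (cur s i) 0; first by left.
  have [cj|cj] := eqVneq (cur s j) 0; first by right.
  case/negP: (na i j Gij).
  by rewrite /admissible lt_min !lt_neqAle !c0 !andbT !(eq_sym 0) ci cj.
exists rho; split=> //.
- move=> i; rewrite /rho; have [ci|ci] := eqVneq (cur s i) 0; first exact: zm.
  by apply: pf => //; rewrite lt_neqAle c0 eq_sym ci.
- by move=> i; split=> //; apply: psd_idempotent.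
have [s2 s0] := sqrt2_bounds R.
have ratio0 : 0 < 2 + Num.sqrt 2 :> R by lra.
(* [mu_star] is an infimum: its set is nonempty, containing the energy of the output, and it remains
   to compare with an arbitrary feasible [sigma]. *)
rewrite mulrC -ler_pdivrMr //; apply: lb_le_inf.
  by exists (energy P (tensor rho)), (tensor rho).
move=> _ [sigma fsigma <-]; rewrite ler_pdivrMr // mulrC.
have psigma : psd sigma := proj1 (proj1 fsigma).
have edge i j : G i j -> weight P i + weight P j <=
    (2 + Num.sqrt 2) * local_energy P sigma i
    + (2 + Num.sqrt 2) * local_energy P sigma j.
  by move=> Gij; rewrite -mulrDr edge_ratio // (adj_neq Gij).
apply: (le_trans _ (le_trans (lr _ _ edge) _)).
  (* Where nothing is left of the coefficient, the output pays exactly the weight; elsewhere it pays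
     0. *)
  rewrite energyE; apply: ler_sum => i _; rewrite product_local_energy // /rho.
  have [w0 w1] := weight_bounds P i; have /andP[_ ccoef] := cb i.
  have [ci|ci] := eqVneq (cur s i) 0; first by rewrite k1e ci subr0.
  have [_ _ _ ->] := compl i.
  by rewrite mulr0 mulr_ge0 ?subr_ge0 //; lra.
(* Putting back the remaining coefficients only increases the energy of [sigma], local energies
   being nonnegative. *)
rewrite energyE mulr_sumr; apply: ler_sum => i _; rewrite mulrCA.
apply: ler_wpM2l; first exact: ltW.
by rewrite ler_wpM2r ?local_energy_ge0 // gerBl.
Qed.

End Approximation.

(** * Lengths of the numbers stored *)

Section Sizes.
Variable R : realType.
Local Notation C := R[i].

Lemma nat_bits_le n k : (n <= 2 ^ k)%N -> (nat_bits n <= k.+1)%N.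
Proof. by move=> nk; rewrite ltnS -[k](@trunc_expnK 2) // leq_trunc_log. Qed.

Lemma nat_bits_ltn n : (n < 2 ^ nat_bits n)%N.
Proof. exact: trunc_log_ltn. Qed.

(** [m / n] need not be reduced, but reducing it enlarges neither numerator nor denominator. *)
Lemma rat_bits_div (q : rat) (m : int) (n k : nat) :
  (0 < n)%N -> q * n%:Q = m%:Q -> (`|m| <= 2 ^ k)%N -> (n <= 2 ^ k)%N ->
  (rat_bits q <= 2 * k + 3)%N.
Proof.
move=> n0 qm mk nk.
have E : (numq q * n = m * denq q)%R.
  apply: (@intr_inj rat); rewrite !rmorphM /= -qm -{2}(divq_num_den q).
  by rewrite mulrAC divfK // intr_eq0 denq_eq0.
have EN : (`|numq q| * n = `|m| * `|denq q|)%N by rewrite -(abszM m) -E abszM.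
have dn : (`|denq q| %| n)%N.
  rewrite -(Gauss_dvdr _ (m := `|denq q|%N) (n := `|numq q|%N)).
    by rewrite EN dvdn_mull.
  by rewrite coprime_sym coprime_num_den.
have dle : (`|denq q| <= n)%N by exact: dvdn_leq.
have nle : (`|numq q| <= `|m|)%N.
  by rewrite -(leq_pmul2r n0) EN leq_mul2l dle orbT.
have := nat_bits_le (leq_trans dle nk); have := nat_bits_le (leq_trans nle mk).
by rewrite /rat_bits; lia.
Qed.

(** The successor in [rat_bits] absorbs the factor 2 from adding two numbers. *)
Lemma num_den_bits (q : rat) : (`|numq q| + `|denq q| <= 2 ^ rat_bits q)%N.
Proof.
have nk := nat_bits_ltn `|numq q|; have dk := nat_bits_ltn `|denq q|.
have mono m n : (m <= n -> 2 ^ m <= 2 ^ n)%N by rewrite leq_exp2l.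
have := mono _ _ (leq_addr (nat_bits `|denq q|) (nat_bits `|numq q|)).
have := mono _ _ (leq_addl (nat_bits `|numq q|) (nat_bits `|denq q|)).
by rewrite /rat_bits expnS; lia.
Qed.

Lemma rat_bits_natB (b : bool) (q : rat) :
  (rat_bits (b%:R - q) <= 2 * rat_bits q + 3)%N.
Proof.
have := num_den_bits q; have d0 : (0 < `|denq q|)%N by rewrite absz_gt0 denq_neq0.
move=> nd; apply: (@rat_bits_div _ (b%:R * denq q - numq q) `|denq q|%N) => //.
- rewrite -[in b%:R - q](divq_num_den q) absz_denq mulrBl divfK ?intr_eq0 ?denq_neq0 //.
  by rewrite rmorphB rmorphM /= rmorph_nat.
- by apply: leq_trans nd; case: b; lia.
- by apply: leq_trans nd; lia.
Qed.

(** The 3 is [rat_bits 0], spent on the imaginary part. *)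
Lemma bits_le_real (q : rat) k : (rat_bits q + 3 <= k)%N ->
  bits_le ((ratr q)%:C : C) k.
Proof.
move=> qk; exists (rat_bits q + 3)%N => //; exists q, 0; split=> //.
by rewrite rmorph0.
Qed.

Lemma bits_le_natB (b : bool) (z : C) l : has_bits z l ->
  bits_le (b%:R - z) (2 * l + 6).
Proof.
move=> [p [q [-> ->]]]; exists (rat_bits (b%:R - p) + rat_bits (0 - q))%N.
  exists (b%:R - p), (0 - q); split=> //.
  by rewrite !rmorphB rmorph0 rmorph_nat; case: b; apply/eqP; rewrite eq_complex /= !eqxx.
have := rat_bits_natB b p.
have : (rat_bits (0 - q) <= 2 * rat_bits q + 3)%N := rat_bits_natB false q.
lia.
Qed.

Variables (V : finType) (G : sgraph V) (P : tvc R G).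

(** An update only subtracts one current coefficient from another, so the multiples of [1 / D] are
    preserved. *)
Lemma cur_multiple (D : R) : (forall i, exists m : int, coef P i * D = m%:~R) ->
  forall t s, execution P t s -> forall i, exists m : int, cur s i * D = m%:~R.
Proof.
move=> coefD t s; elim=> [|{}t {}s s' _ IH st] i.
  by have [m mE] := coefD i; exists m; rewrite ffunE.
case: st IH => //= e c _ IH; rewrite subtract_minE.
have [m mE] := IH i; case: ifP => _; last by exists m; rewrite subr0.
have [m1 m1E] := IH e.1; have [m2 m2E] := IH e.2.
rewrite minEle; case: ifP => _.
  by exists (m - m1); rewrite mulrBl mE m1E rmorphB.
by exists (m - m2); rewrite mulrBl mE m2E rmorphB.
Qed.

Lemma cur_bits L t s i : encoding_length P L -> execution P t s ->
  bits_le (cur s i)%:C (4 * L + 6).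
Proof.
move=> [lc [lp [hc _ LE]]] ex.
have /fin_all_exists[q qP] : forall k, exists q : rat,
    coef P k = ratr q /\ (rat_bits q <= lc k)%N.
  move=> k; have [a [b [E ->]]] := hc k; exists a; split; last exact: leq_addr.
  by case: E.
have sumL : (\sum_k lc k <= L)%N.
  by rewrite LE (leq_trans _ (leq_addl _ _)) // leq_sum // => k _; exact: leq_addr.
pose D := (\prod_k `|denq (q k)|)%N.
have D0 : (0 < D)%N by rewrite prodn_gt0 // => k; rewrite absz_gt0 denq_neq0.
have DL : (D <= 2 ^ L)%N.
  apply: (@leq_trans (2 ^ \sum_k lc k)); last by rewrite leq_exp2l.
  rewrite expn_sum; apply: leq_prod => k _.
  apply: leq_trans (leq_trans (leq_addl _ _) (num_den_bits (q k))) _.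
  by rewrite leq_exp2l // (proj2 (qP k)).
have coefD k : exists m : int, coef P k * D%:R = m%:~R.
  rewrite (proj1 (qP k)) /D (bigD1 k) //=; set E := (\prod_(_ | _) _)%N.
  exists (numq (q k) * E); rewrite natrM mulrA rmorphM /= -[E%:R]/(E%:Z%:~R).
  congr (_ * _).
  rewrite -[_%:R]/(`|denq (q k)|%:Z%:~R) absz_denq -!(ratr_int R) -rmorphM /=.
  by rewrite -{1}(divq_num_den (q k)) divfK // intr_eq0 denq_neq0.
have [m mE] := cur_multiple coefD ex i.
have Dn0 : D%:R != 0 :> R by rewrite pnatr_eq0 -lt0n.
have curE : cur s i = ratr (m%:Q / D%:Q).
  by rewrite fmorph_div /= !ratr_int -mE mulfK.
have [[cb _] _ _] := state_inv_execution ex; have /andP[c0 cc] := cb i.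
(* Coefficients never grow, so [m] is at most the initial numerator times [D], each bounded by
   [2 ^ L]. *)
have mL : (`|m| <= 2 ^ (2 * L))%N.
  have m0 : 0 <= m by rewrite -(ler0z R) -mE mulr_ge0.
  have : m%:~R <= (`|numq (q i)| * D)%:R :> R.
    rewrite -mE natrM; apply: ler_wpM2r; first exact: ler0n.
    apply: le_trans cc _; rewrite (proj1 (qP i)).
    have q0 : 0 <= q i by rewrite -(ler0q R) -(proj1 (qP i)) coef_ge0.
    rewrite -(ratr_nat R) ler_rat -[X in X <= _](divq_num_den (q i)).
    rewrite ler_pdivrMr ?ltr0z ?denq_gt0 //.
    rewrite -[_%:R]/(`|numq (q i)|%:Z%:~R) gez0_abs ?numq_ge0 // ler_peMr ?ler0z ?numq_ge0 //.
    by rewrite ler1z -gtz0_ge1 denq_gt0.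
  rewrite -[(_ * D)%:R]/((_ * D)%N%:Z%:~R) ler_int => mle.
  have {}mle : (`|m| <= `|numq (q i)| * D)%N by lia.
  apply: leq_trans mle _; rewrite mul2n -addnn expnD leq_mul //.
  apply: leq_trans (leq_trans (leq_addr _ _) (num_den_bits (q i))) _.
  rewrite leq_exp2l // (leq_trans (proj2 (qP i))) // (leq_trans _ sumL) //.
  by rewrite (bigD1 i) //= leq_addr.
rewrite curE; apply: bits_le_real.
have DL2 : (D <= 2 ^ (2 * L))%N by rewrite (leq_trans DL) // leq_exp2l // leq_pmull.
have qm : m%:Q / D%:Q * D%:Q = m%:Q by rewrite divfK // intr_eq0 -lt0n.
by have := rat_bits_div D0 qm mL DL2; lia.
Qed.

Lemma state_bits L t s : encoding_length P L -> execution P t s ->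
  state_bits_le s (4 * L + 8).
Proof.
move=> enc ex; split=> [i|i A oA a b].
  by have [l hl ll] := cur_bits i enc ex; exists l => //; lia.
have [_ _ /(_ i A oA)] := state_inv_execution ex.
case=> ->.
  (* The entries are 0 or 1; both have [rat_bits] 3, and so has the imaginary part. *)
  rewrite !mxE; exists 6; last lia.
  case: (_ && _).
    by exists 1, 0; split=> //; rewrite rmorph0 (ratr_nat R 1).
  by exists 0, 0; split=> //; rewrite (ratr_nat R 0).
have [lc [lp [_ hp LE]]] := enc.
rewrite !mxE; have [l hl ll] := bits_le_natB (a == b) (hp i a b).
exists l => //; apply: leq_trans ll _.
suff : (lp i a b <= L)%N by lia.
rewrite LE (leq_trans _ (leq_addl _ _)) // (bigD1 i) //= (leq_trans _ (leq_addr _ _)) //.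
rewrite (leq_trans _ (leq_addl _ _)) // (bigD1 a) //= (leq_trans _ (leq_addr _ _)) //.
by rewrite (bigD1 b) //= leq_addr.
Qed.

End Sizes.

Theorem theorem5 :
  exists time size : {poly nat},
  forall (R : realType) (V : finType) (G : sgraph V) (P : tvc R G),
  [/\ (* the number of elementary operations is polynomial, ... *)
      forall t s, execution P t s -> (t <= time.[#|V| + #|edges G|])%N,
      (* ... and so is the length of the numbers computed; *)
      forall L t s, encoding_length P L -> execution P t s ->
        state_bits_le s size.[L],
      (* an execution only stops at Halt; *)
      forall t s, execution P t s -> halted s \/ exists s', step P s s'
    & (* whatever the choices made, the output is as claimed *)
      forall t s, execution P t s -> halted s ->
        exists rho : V -> 'M[R[i]]_2,
          [/\ forall i, out s i = Some (rho i),
              forall i, density (rho i),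
              feasible G (tensor rho)
            & energy P (tensor rho) <= (2 + Num.sqrt 2) * mu_star P]].
Proof.
(* The bounds of [execution_time] and [state_bits]; the first is monotone, so [|V|] may be replaced
   by [|V| + |E|]. *)
exists (('X + 1%:P) * (2%:P * 'X + 'X ^+ 2 + 3%:P)), (4%:P * 'X + 8%:P) => R V G P.
split=> [t s ex|L t s enc ex|t s _|t s ex].
- rewrite !(hornerM, hornerD, hornerC, hornerX, hornerXn).
  apply: leq_trans (execution_time ex) _.
  have V0 : (#|V| <= #|V| + #|edges G|)%N := leq_addr _ _.
  set n := (_ + _)%N in V0 *.
  rewrite -[X in (_ <= X)%N]/((n + 1) * (2 * n + n ^ 2 + 3))%N.
  by rewrite leq_mul ?addn1 // leq_add // leq_add ?leq_mul ?leq_exp2r.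
- by rewrite !(hornerM, hornerD, hornerC, hornerX); apply: state_bits enc ex.
- exact: progress.
- exact: halted_output (state_inv_execution ex).
Qed.
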